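(* Let $w=[x^\top,y^\top,z^\top]^\top$ be the unique solution of the double saddle point problem $\mathfrak{B}w=b$, and let $L\in\mathbb{R}^{k\times l}$. When $\tau=\gamma=\infty$, the partial condition number of $w$ with respect to $L$ is $$\mathfrak{K}^{\infty}_{\varphi}(\mathbf{H},b;L)=\left\||\Theta_{\xi_L^\ddagger}|\,\left|L\mathfrak{B}^{-1}\begin{bmatrix}\mathcal{G}&-I_l\end{bmatrix}\right|\begin{bmatrix}\mathrm{vec}(|\Psi|) \\ |\chi|\end{bmatrix}\right\|_\infty.$$ Moreover, suppose $Lw\neq0$ and take $\Psi=\mathbf{H}$, $\chi=b$. If $\xi_L=\|Lw\|_\infty\mathbf{1}_k$, the resulting partial condition number (the partial mixed condition number) is $$\mathfrak{K}^{\infty}_{mix,\varphi}(\mathbf{H},b;L)=\frac{\left\|\left|L\mathfrak{B}^{-1}\begin{bmatrix}\mathcal{G}&-I_l\end{bmatrix}\right|\begin{bmatrix}\mathrm{vec}(|\mathbf{H}|) \\ |b|\end{bmatrix}\right\|_\infty}{\|Lw\|_\infty},$$ and if $\xi_L=Lw$, the resulting partial condition number (the partial componentwise condition number) is $$\mathfrak{K}^{\infty}_{com,\varphi}(\mathbf{H},b;L)=\left\|\frac{\left|L\mathfrak{B}^{-1}\begin{bmatrix}\mathcal{G}&-I_l\end{bmatrix}\right|\begin{bmatrix}\mathrm{vec}(|\mathbf{H}|) \\ |b|\end{bmatrix}}{|Lw|}\right\|_\infty.$$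
   Context: Let $A\in\mathbb{R}^{n\times n}$, $B\in\mathbb{R}^{m\times n}$, $C\in\mathbb{R}^{p\times m}$, $D\in\mathbb{R}^{m\times m}$, $E\in\mathbb{R}^{p\times p}$, $l=n+m+p$, $b\in\mathbb{R}^{l}$, and $$\mathfrak{B}=\begin{bmatrix} A & B^\top & 0 \\ B & -D & C^\top \\ 0 & C & E \end{bmatrix},$$ which is assumed nonsingular throughout. The double saddle point problem (DSPP) is $\mathfrak{B}w=b$ with $w=[x^\top,y^\top,z^\top]^\top$, $x\in\mathbb R^n$, $y\in\mathbb R^m$, $z\in\mathbb R^p$. Notation: $\mathrm{vec}$ stacks the columns of a matrix; for a tuple of matrices $\mathrm{vec}(X_1,\dots,X_r)=[\mathrm{vec}(X_1)^\top,\dots,\mathrm{vec}(X_r)^\top]^\top$. $\otimes$ is the Kronecker product and $\odot$ the entrywise product. $|X|$ is the entrywise absolute value. Operations $\odot$, $|\cdot|$, $\ddagger$ are applied componentwise to tuples. $\Theta_v$ is the diagonal matrix with diagonal $v$. For a vector or matrix $v$, $v^\ddagger$ has entries $1/v_i$ if $v_i\ne0$ and $1$ if $v_i=0$. The entrywise quotient of vectors is $\frac{u}{v}=v^\ddagger\odot u$. $\mathbf{1}_k$ is the all-ones vector in $\mathbb R^k$. Write $\mathbf{H}=(A,B,C,D,E)$, $s=n^2+m^2+p^2+nm+mp$, and $$\mathcal{G}=\begin{bmatrix} x^\top\otimes I_n & I_n\otimes y^\top & 0 & 0 & 0 \\ 0 & x^\top\otimes I_m & I_m\otimes z^\top & -y^\top\otimes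 I_m & 0 \\ 0 & 0 & y^\top\otimes I_p & 0 & z^\top\otimes I_p \end{bmatrix}\in\mathbb{R}^{l\times s}.$$ For $L\in\mathbb{R}^{k\times l}$ ($k\le l$) put $\varphi(\mathbf{H},b)=L\mathfrak{B}^{-1}b$. Let $\xi_L\in\mathbb{R}^k$, $\Psi=(\Psi_A,\Psi_B,\Psi_C,\Psi_D,\Psi_E)$ with components of the same sizes as $A,B,C,D,E$, and $\chi\in\mathbb{R}^l$ be parameters. For $\tau=\gamma=\infty$ the partial condition number of $w$ with respect to $L$ is $$\mathfrak{K}^{\infty}_{\varphi}(\mathbf{H},b;L)=\lim_{\epsilon\to0}\ \sup_{0<\|\mathrm{vec}(\Psi^\ddagger\odot\Delta\mathbf{H},\,\chi^\ddagger\odot\Delta b)\|_\infty\le\epsilon}\frac{\|\xi_L^\ddagger\odot(\varphi(\mathbf{H}+\Delta\mathbf{H},b+\Delta b)-\varphi(\mathbf{H},b))\|_\infty}{\|\mathrm{vec}(\Psi^\ddagger\odot\Delta\mathbf{H},\,\chi^\ddagger\odot\Delta b)\|_\infty},$$ where $\Delta\mathbf{H}=(\Delta A,\Delta B,\Delta C,\Delta D,\Delta E)$ and $\Delta b$ range over perturbations whose entries are zero wherever the corresponding entry of $\Psi$, respectively $\chi$, is zero. *)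

(* Defs.v *)
From HB Require Import structures.
From mathcomp Require Import all_boot all_order all_algebra.
From mathcomp Require Import all_classical all_reals all_analysis.
From mathcomp.real_closed Require Import mxtens.
Set Implicit Arguments.
Unset Strict Implicit.
Unset Printing Implicit Defensive.
Import Order.TTheory GRing.Theory Num.Theory.
Import numFieldNormedType.Exports.
Local Open Scope classical_set_scope.
Local Open Scope ring_scope.

(* On matrices, `|M| is the MathComp-Analysis norm max_(i, j) `|M i j|; on
   column vectors it is the infinity norm. The entrywise absolute value is
   [absmx]. *)

Section Entrywise.
Context {R : realType}.
Implicit Types a b : nat.

Definition absmx {a b} (M : 'M[R]_(a, b)) : 'M[R]_(a, b) :=
  map_mx (fun t => `|t|) M.

Definition ddag {a b} (M : 'M[R]_(a, b)) : 'M[R]_(a, b) :=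
  map_mx (fun t => if t == 0 then 1 else t^-1) M.

Definition hadamard {a b} (M N : 'M[R]_(a, b)) : 'M[R]_(a, b) :=
  map2_mx *%R M N.

Definition ediv {a} (u v : 'cV[R]_a) : 'cV[R]_a := hadamard (ddag v) u.

Definition Theta {a} (v : 'cV[R]_a) : 'M[R]_a := diag_mx v^T.

Definition zero_off {a b} (P M : 'M[R]_(a, b)) : Prop :=
  forall i j, P i j = 0 -> M i j = 0.

(* [mxvec] concatenates rows, hence the transposes: columns are stacked. *)
Definition vec {a b} (M : 'M[R]_(a, b)) : 'cV[R]_(b * a) := (mxvec M^T)^T.

(* Kronecker products with a row vector; the casts only turn the row
   dimensions 1 * b and b * 1 into b. *)
Definition kron_rowl {a} (v : 'cV[R]_a) b : 'M[R]_(b, a * b) :=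
  castmx (mul1n b, erefl (a * b)%N) (v^T *t (1%:M : 'M[R]_b)).

Definition kron_rowr b {a} (v : 'cV[R]_a) : 'M[R]_(b, b * a) :=
  castmx (muln1 b, erefl (b * a)%N) ((1%:M : 'M[R]_b) *t v^T).

End Entrywise.

(* The tuples (A, B, C, D, E), with the componentwise addition of products. *)
Definition dspp (R : realType) (n m p : nat) : Type :=
  ('M[R]_(n, n) * 'M[R]_(m, n) * 'M[R]_(p, m) * 'M[R]_(m, m) * 'M[R]_(p, p))%type.

Section DoubleSaddlePoint.
Context {R : realType} {n m p : nat}.
Implicit Types H Psi dH : dspp R n m p.

Definition dspp_map (f : forall a b : nat, 'M[R]_(a, b) -> 'M[R]_(a, b)) H :
    dspp R n m p :=
  let: (A, B, C, D, E) := H in (f _ _ A, f _ _ B, f _ _ C, f _ _ D, f _ _ E).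

Definition dspp_abs H := dspp_map (fun _ _ => absmx) H.

Definition dspp_ddag H := dspp_map (fun _ _ => ddag) H.

Definition dspp_hadamard H1 H2 : dspp R n m p :=
  let: (A1, B1, C1, D1, E1) := H1 in
  let: (A2, B2, C2, D2, E2) := H2 in
  (hadamard A1 A2, hadamard B1 B2, hadamard C1 C2, hadamard D1 D2,
   hadamard E1 E2).

Definition dspp_vec H :
    'cV[R]_(n * n + (n * m + (m * p + (m * m + p * p)))) :=
  let: (A, B, C, D, E) := H in
  col_mx (vec A) (col_mx (vec B) (col_mx (vec C) (col_mx (vec D) (vec E)))).

Definition dspp_mx H : 'M[R]_(n + (m + p)) :=
  let: (A, B, C, D, E) := H in
  col_mx (row_mx A (row_mx B^T 0))
 (col_mx (row_mx B (row_mx (- D) C^T))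
         (row_mx 0 (row_mx C E))).

Definition calG (x : 'cV[R]_n) (y : 'cV[R]_m) (z : 'cV[R]_p) :
    'M[R]_(n + (m + p), n * n + (n * m + (m * p + (m * m + p * p)))) :=
  col_mx (row_mx (kron_rowl x n)
           (row_mx (kron_rowr n y) (row_mx 0 (row_mx 0 0))))
 (col_mx (row_mx 0
           (row_mx (kron_rowl x m)
             (row_mx (kron_rowr m z) (row_mx (- kron_rowl y m) 0))))
         (row_mx 0
           (row_mx 0
             (row_mx (kron_rowl y p) (row_mx 0 (kron_rowl z p)))))).

(* The vector vec(H, b). *)
Definition data_vec H (b : 'cV[R]_(n + (m + p))) := col_mx (dspp_vec H) b.

Section ConditionNumber.
Context {k : nat} (L : 'M[R]_(k, n + (m + p))) (xi : 'cV[R]_k).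
Variables (Psi : dspp R n m p) (chi : 'cV[R]_(n + (m + p))).
Variables (H : dspp R n m p) (b : 'cV[R]_(n + (m + p))).

Definition phi H0 (b0 : 'cV[R]_(n + (m + p))) : 'cV[R]_k :=
  L *m invmx (dspp_mx H0) *m b0.

Definition weighted_norm dH (db : 'cV[R]_(n + (m + p))) : R :=
  `|data_vec (dspp_hadamard (dspp_ddag Psi) dH) (hadamard (ddag chi) db)|.

(* The unit condition keeps H + dH in the domain of [phi] ([invmx] is total);
   it is automatic for small eps when [dspp_mx H] is nonsingular. *)
Definition admissible (eps : R) :
    set (dspp R n m p * 'cV[R]_(n + (m + p))) :=
  [set d | [/\ zero_off (data_vec Psi chi) (data_vec d.1 d.2),
               0 < weighted_norm d.1 d.2 <= eps &
               dspp_mx (H + d.1) \in unitmx]].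

Definition rel_quotient (d : dspp R n m p * 'cV[R]_(n + (m + p))) : R :=
  `|hadamard (ddag xi) (phi (H + d.1) (b + d.2) - phi H b)|
    / weighted_norm d.1 d.2.

(* The supremum of the nonnegative quotients is taken in [0, +oo]: adjoining 0
   matters only when no perturbation is admissible (all the entries of Psi and
   chi are 0), in which case the supremum is 0. *)
Definition sup_quotient (eps : R) : \bar R :=
  ereal_sup (0%E |` [set (rel_quotient d)%:E | d in admissible eps]).

Definition partial_cond : \bar R := lim (sup_quotient eps @[eps --> 0^'+]).

End ConditionNumber.

End DoubleSaddlePoint.

(* Main.v *)
Require Import Defs.
From HB Require Import structures.
From mathcomp Require Import all_boot all_order all_algebra.
From mathcomp Require Import all_classical all_reals all_analysis.
From mathcomp.real_closed Require Import mxtens.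
From mathcomp Require Import ring lra.
Import Order.TTheory GRing.Theory Num.Theory.
Import numFieldNormedType.Exports.
Local Open Scope classical_set_scope.
Local Open Scope ring_scope.

(** Write [X] for the block matrix, [X'] for the perturbed one and [J] for
    [[calG, -I]]. The matrix [calG] is built so that [calG *m vec(dH)] equals
    [(X' - X) *m w] ([calG_vec]). Since [b = X *m w], the perturbed solution
    satisfies the exact identity
      [X'^-1 (b + db) - w = - X'^-1 (J vec(dH, db))]   ([phi_perturb]),
    with no higher order remainder: all the nonlinearity sits in [X'^-1].

    Replacing [X'^-1] by [X^-1] costs an error quadratic in the size of the
    perturbation, because [X'^-1] is Lipschitz in [X'] near [X]
    ([invmx_perturb], which also shows that small perturbations stay
    invertible). Hence the quotients under the supremum differ from those of
    the linear map [N = Theta(xi^ddag) L X^-1 J] by [O(eps)], uniformly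
    ([quotient_first_order]).

    For a linear map the quotient has an exact maximum. A perturbation
    supported on the nonzero entries of [P = (Psi, chi)] is [P] times a free
    vector [u] whose maximum norm is the weighted norm, so the maximum is the
    operator norm of [N diag(P)] for the maximum norm: its largest absolute
    row sum, which is the largest entry of [|N| |P|]. It is reached, at any prescribed size, by giving [u]
    the signs that make every term of the largest row nonnegative
    ([linear_quotient_le], [linear_quotient_attained]). Therefore the supremum
    at [eps] lies within [O(eps)] of [| |N| |P| |], and so does its limit
    ([sup_quotient_cvg]). The mixed and componentwise formulas are the
    specializations of [Theta] to a constant weight and to [L w]. *)

(** * Kronecker products acting on vectorized matrices *)

Lemma index_allpairs_pair {S T : eqType} (s : seq S) (t : seq T) (x : S) (y : T) :
  x \in s -> y \in t ->
  index (x, y) [seq (a, c) | a <- s, c <- t] = (index x s * size t + index y t)%N.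
Proof.
move=> + yt; elim: s => //= a s IH; rewrite inE index_cat.
have [->|ax] := eqVneq x a => /=.
  move=> _; rewrite (map_f (fun c => (a, c)) yt) mul0n add0n.
  by rewrite (@index_map _ _ (fun c => (a, c))) // => ? ? [].
move=> /IH ->; case: mapP => [[c _ [xa _]]|_].
  by rewrite xa eqxx in ax.
by rewrite size_map mulSn addnA.
Qed.

(** Kronecker products number pairs by the explicit formula [i * c + j],
    whereas [mxvec] goes through the enumeration of the type of pairs; both
    are the lexicographic order. *)
Lemma mxtens_index_mxvec {a c} (i : 'I_a) (j : 'I_c) :
  mxtens_index (i, j) = mxvec_index i j.
Proof.
apply: val_inj => /=; rewrite /enum_rank enum_rank_in.unlock insubdK; last first.
  by rewrite -topredE /= cardE index_mem mem_enum.
rewrite enumT [Finite.enum]unlock /= /prod_enum index_allpairs_pair ?mem_enum //.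
by rewrite size_enum_ord !index_enum_ord.
Qed.

Section Vectorization.
Context {R : realType}.

Lemma vec_mxvec_index {a c} (M : 'M[R]_(c, a)) j i :
  vec M (mxvec_index j i) 0 = M i j.
Proof. by rewrite mxE mxvecE mxE. Qed.

Lemma mul_kron_rowl {a c} (x : 'cV[R]_a) (M : 'M[R]_(c, a)) :
  kron_rowl x c *m vec M = M *m x.
Proof.
apply/colP => i; rewrite !mxE (reindex _ (curry_mxvec_bij a c)) /=.
transitivity (\sum_j \sum_i' x j 0 * (i == i')%:R * M i' j).
  rewrite pair_bigA; apply: eq_bigr => -[j i'] _ /=.
  rewrite vec_mxvec_index /kron_rowl castmxE mxE !cast_ord_id -mxtens_index_mxvec.
  rewrite mxtens_indexK /= !mxE.
  by rewrite [X in x j X]ord1 -!val_eqE /= modn_small.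
apply: eq_bigr => j _; rewrite (bigD1 i) //= big1 ?addr0 => [|i' i'i].
  by rewrite eqxx mulr1 mulrC.
by rewrite eq_sym (negPf i'i) mulr0 mul0r.
Qed.

Lemma mul_kron_rowr {a c} (y : 'cV[R]_a) (M : 'M[R]_(a, c)) :
  kron_rowr c y *m vec M = M^T *m y.
Proof.
apply/colP => i; rewrite !mxE (reindex _ (curry_mxvec_bij c a)) /=.
transitivity (\sum_i' \sum_j (i == i')%:R * y j 0 * M j i').
  rewrite pair_bigA; apply: eq_bigr => -[i' j] _ /=.
  rewrite vec_mxvec_index /kron_rowr castmxE mxE !cast_ord_id -mxtens_index_mxvec.
  rewrite mxtens_indexK /= !mxE.
  by rewrite [X in y j X]ord1 -!val_eqE /= divn1.
rewrite (bigD1 i) //= [X in _ + X]big1 ?addr0 => [|i' i'i].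
  by apply: eq_bigr => j _; rewrite eqxx mul1r mxE mulrC.
by rewrite big1 // => j _; rewrite eq_sym (negPf i'i) !mul0r.
Qed.

End Vectorization.

(** * The maximum norm of matrices *)

Section MaxNorm.
Context {R : realType}.

Lemma normr_mx_entry {a c} (M : 'M[R]_(a, c)) i j : `|M i j| <= `|M|.
Proof.
rewrite [leRHS]/Num.Def.normr /= mx_normrE.
exact: (le_bigmax 0 (fun ij : 'I_a * 'I_c => `|M ij.1 ij.2|) (i, j)).
Qed.

Lemma mx_norm_le {a c} (M : 'M[R]_(a, c)) (e : R) : 0 <= e ->
  (forall i j, `|M i j| <= e) -> `|M| <= e.
Proof.
by move=> e0 Me; rewrite [leLHS]/Num.Def.normr /= mx_normrE; apply: bigmax_le.
Qed.

Lemma mx_norm_attained {a c} (M : 'M[R]_(a, c)) : M != 0 ->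
  exists i j, `|M| = `|M i j|.
Proof.
by rewrite -normr_eq0 => /mx_norm_neq0 [[i j] Mij]; exists i, j.
Qed.

Lemma mx_norm_mul {a c d} (M : 'M[R]_(a, c)) (N : 'M[R]_(c, d)) :
  `|M *m N| <= c%:R * `|M| * `|N|.
Proof.
apply: mx_norm_le => [|i j]; first by rewrite !mulr_ge0.
rewrite mxE (le_trans (ler_norm_sum _ _ _)) //.
have -> : c%:R * `|M| * `|N| = \sum_(h < c) (`|M| * `|N|).
  by rewrite sumr_const card_ord -mulrA mulr_natl.
by apply: ler_sum => h _; rewrite normrM ler_pM ?normr_mx_entry.
Qed.

Lemma unitmx_of_trivial_kernel {a} (X : 'M[R]_a) :
  (forall v : 'cV_a, X *m v = 0 -> v = 0) -> X \in unitmx.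
Proof.
move=> Xinj; rewrite -unitmx_tr -row_free_unit -kermx_eq0.
apply/eqP/row_matrixP => i; rewrite row0.
apply: trmx_inj; rewrite trmx0; apply: Xinj.
apply: trmx_inj; rewrite trmx_mul trmxK trmx0.
by rewrite -row_mul mulmx_ker row0.
Qed.

(** If [v = (X + dX)^-1 r] and [v0 = X^-1 r], then [v = v0 - X^-1 dX v], so
    once [X^-1 dX] has norm at most [1/2] the norm of [v] is at most twice that
    of [v0], and [v - v0 = - X^-1 dX v] is of order [|dX| |r|]. The same bound
    with [r = 0] shows that [X + dX] has a trivial kernel. *)
Lemma invmx_perturb {a} (X : 'M[R]_a) : X \in unitmx ->
  exists2 K : R, 0 < K & forall dX : 'M[R]_a, K * `|dX| <= 1 ->
    X + dX \in unitmx /\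
    forall r : 'cV_a, `|invmx (X + dX) *m r - invmx X *m r| <= K * `|dX| * `|r|.
Proof.
move=> Xu.
pose c : R := a%:R * `|invmx X|.
pose c' : R := a%:R * a%:R * `|invmx X|.
have c0 : 0 <= c by rewrite mulr_ge0.
have c'0 : 0 <= c' by rewrite !mulr_ge0.
(* The summand [2 * c'] enforces [c' * |dX| <= 1/2], the summand [2 * c' * c]
   is the Lipschitz constant, and [1] makes the total positive. *)
exists (1 + 2 * c' + 2 * c' * c); first by rewrite -addrA ltr_pwDl ?addr_ge0 ?mulr_ge0.
move=> dX; set K := _ + _ => KdX.
have Xd (v : 'cV_a) : `|invmx X *m (dX *m v)| <= c' * `|dX| * `|v|.
  rewrite (le_trans (mx_norm_mul _ _)) // -!mulrA ler_wpM2l //.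
  rewrite [leRHS]mulrCA ler_wpM2l //.
  by rewrite (le_trans (mx_norm_mul _ _)) // mulrA.
have half : c' * `|dX| <= 2^-1.
  have := normr_ge0 dX; rewrite /K in KdX; have := mulr_ge0 c'0 c0; nra.
have u : X + dX \in unitmx.
  apply: unitmx_of_trivial_kernel => v; rewrite mulmxDl => /eqP; rewrite addr_eq0 => /eqP Xv.
  apply/eqP; rewrite -normr_le0.
  have : v = - (invmx X *m (dX *m v)) by rewrite -mulmxN -Xv mulKmx.
  move=> /(congr1 Num.Def.normr); rewrite normrN => nv.
  have := Xd v; rewrite -nv; have := normr_ge0 v; nra.
split=> // r; set v := invmx (X + dX) *m r; set v0 := invmx X *m r.
have vE : v - v0 = - (invmx X *m (dX *m v)).
  by rewrite -[v in LHS](mulKmx Xu) -mulmxBr -mulmxN; congr (_ *m _);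
    rewrite -[r](mulKVmx u) -/v mulmxDl opprD addNKr.
rewrite vE normrN.
have dv : `|v| <= 2 * `|v0|.
  have := ler_normD v0 (v - v0); rewrite addrC subrK vE normrN; have := Xd v; have := normr_ge0 v; nra.
have v0r : `|v0| <= c * `|r| by exact: mx_norm_mul.
rewrite (le_trans (Xd v)) //.
have : c' * `|dX| * `|v| <= c' * `|dX| * (2 * (c * `|r|)).
  by rewrite ler_wpM2l ?mulr_ge0 // (le_trans dv) // ler_wpM2l.
move=> /le_trans; apply.
have -> : c' * `|dX| * (2 * (c * `|r|)) = 2 * c' * c * `|dX| * `|r| by ring.
rewrite ler_wpM2r // ler_wpM2r // /K lerDr addr_ge0 ?mulr_ge0 //.
Qed.

End MaxNorm.

(** * The weighted norm of a linear map *)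

Section LinearQuotient.
Context {R : realType} {k q : nat}.
Implicit Types (N : 'M[R]_(k, q)) (P d : 'cV[R]_q).

Lemma unweighted_entry P d : zero_off P d ->
  forall j, `|d j 0| = `|P j 0| * `|hadamard (ddag P) d j 0|.
Proof.
move=> Pd j; rewrite !mxE; case: eqVneq => [P0|P0].
  by rewrite (Pd _ _ P0) mulr0 normr0 mulr0.
by rewrite -normrM mulVKf.
Qed.

Lemma linear_quotient_le N P d : zero_off P d ->
  `|N *m d| <= `|absmx N *m absmx P| * `|hadamard (ddag P) d|.
Proof.
move=> Pd; apply: mx_norm_le => [|i j]; first exact: mulr_ge0.
rewrite ord1 !mxE (le_trans (ler_norm_sum _ _ _)) //.
apply: le_trans (ler_wpM2r (normr_ge0 _) (normr_mx_entry _ i 0)).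
rewrite !mxE ger0_norm; last by apply: sumr_ge0 => h _; rewrite !mxE mulr_ge0.
rewrite mulr_suml; apply: ler_sum => h _; rewrite !mxE normrM -mulrA ler_wpM2l //.
by rewrite (unweighted_entry _ _ Pd) ler_wpM2l // normr_mx_entry.
Qed.

(** Aligning the signs of [d] with those of the row of [N] that realizes the
    norm removes all cancellation in that row. The nonvanishing condition
    provides an index where [d] is nonzero. *)
Lemma linear_quotient_attained N P (t : R) : 0 < t -> absmx N *m absmx P != 0 ->
  exists d, [/\ zero_off P d, `|hadamard (ddag P) d| = t &
    `|absmx N *m absmx P| * t <= `|N *m d|].
Proof.
move=> t0 NP0; have [i [j NPij]] := mx_norm_attained _ NP0.
rewrite ord1 in NPij.
pose d : 'cV[R]_q := \col_h (t * Num.sg (N i h) * `|P h 0|).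
have Pd : zero_off P d by move=> h o; rewrite ord1 !mxE => ->; rewrite normr0 mulr0.
have dN : `|absmx N *m absmx P| * t <= `|N *m d|.
  apply: le_trans (normr_mx_entry _ i 0); rewrite NPij !mxE.
  rewrite ger0_norm; last by apply: sumr_ge0 => h _; rewrite !mxE mulr_ge0.
  rewrite mulr_suml (le_trans _ (ler_norm _)) //; apply: ler_sum => h _.
  by rewrite !mxE [`|N i h|]normrEsg; rewrite le_eqVlt; apply/orP; left; apply/eqP; ring.
exists d; split=> //; apply/eqP; rewrite eq_le; apply/andP; split.
  apply: mx_norm_le => [|h o]; first exact: ltW.
  rewrite ord1 !mxE !normrM (gtr0_norm t0) normr_id.
  case: eqVneq => [->|P0]; first by rewrite normr0 !mulr0 ltW.
  rewrite normfV mulrC mulfK ?normr_eq0 //.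
  by rewrite ler_piMr // ?(ltW t0) // normr_sg lern1 leq_b1.
(* The size of [d] is at least [t] because a smaller size would contradict the
   upper bound on the quotient. *)
rewrite -(ler_pM2l (x := `|absmx N *m absmx P|)) ?normr_gt0 //.
exact: le_trans dN (linear_quotient_le _ _ _ Pd).
Qed.

End LinearQuotient.

(** * The data of the double saddle point problem *)

Section VecEntrywise.
Context {R : realType}.

Lemma vec_hadamard {a c} (M N : 'M[R]_(a, c)) : vec (hadamard M N) = hadamard (vec M) (vec N).
Proof.
by apply/colP => h; case/mxvec_indexP: h => j i; rewrite [RHS]mxE !vec_mxvec_index mxE.
Qed.

Lemma vec_map {a c} (f : R -> R) (M : 'M[R]_(a, c)) : vec (map_mx f M) = map_mx f (vec M).
Proof.
by apply/colP => h; case/mxvec_indexP: h => j i; rewrite [RHS]mxE !vec_mxvec_index mxE.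
Qed.

Lemma vec_surj {a c} (v : 'cV[R]_(c * a)) : exists M : 'M[R]_(a, c), vec M = v.
Proof. by exists (vec_mx v^T)^T; rewrite /vec trmxK vec_mxK trmxK. Qed.

Lemma mx_norm_vec {a c} (M : 'M[R]_(a, c)) : `|M| <= `|vec M|.
Proof.
by apply: mx_norm_le => // i j; rewrite -vec_mxvec_index normr_mx_entry.
Qed.

Lemma mx_norm_trmx {a c} (M : 'M[R]_(a, c)) : `|M^T| <= `|M|.
Proof. by apply: mx_norm_le => // i j; rewrite mxE normr_mx_entry. Qed.

Lemma mx_norm_col_mx {a c e} (M : 'M[R]_(a, e)) (N : 'M[R]_(c, e)) :
  `|col_mx M N| = Num.max `|M| `|N|.
Proof.
apply/eqP; rewrite eq_le; apply/andP; split.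
  apply: mx_norm_le => [|i j]; first by rewrite le_max normr_ge0.
  by rewrite mxE le_max; case: fintype.split => h; rewrite normr_mx_entry ?orbT.
rewrite ge_max; apply/andP; split; apply: mx_norm_le => // i j.
  by rewrite -(col_mxEu M N) normr_mx_entry.
by rewrite -(col_mxEd M N) normr_mx_entry.
Qed.

Lemma mx_norm_row_mx {a c e} (M : 'M[R]_(e, a)) (N : 'M[R]_(e, c)) :
  `|row_mx M N| <= Num.max `|M| `|N|.
Proof.
apply: mx_norm_le => [|i j]; first by rewrite le_max normr_ge0.
by rewrite mxE le_max; case: fintype.split => h; rewrite normr_mx_entry ?orbT.
Qed.

Lemma hadamard_col_mx {a c} (u u' : 'cV[R]_a) (v v' : 'cV[R]_c) :
  hadamard (col_mx u v) (col_mx u' v') = col_mx (hadamard u u') (hadamard v v').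
Proof. by apply/colP => i; rewrite !mxE; case: fintype.split => h; rewrite ?mxE. Qed.

End VecEntrywise.

Section Structure.
Context {R : realType} {n m p : nat}.
Implicit Types (H dH Psi : dspp R n m p) (b db chi : 'cV[R]_(n + (m + p))).

Lemma dspp_mxD H dH : dspp_mx (H + dH) = dspp_mx H + dspp_mx dH.
Proof.
case: H => -[[[A B] C] D] E; case: dH => -[[[A' B'] C'] D'] E'.
rewrite /dspp_mx /= !add_col_mx !add_row_mx !addr0.
by rewrite opprD !linearD.
Qed.

(** This identity is the purpose of [calG]: the action of a perturbation on
    the solution is read as a linear function of the entries perturbed. *)
Lemma calG_vec dH (x : 'cV[R]_n) (y : 'cV[R]_m) (z : 'cV[R]_p) :
  calG x y z *m dspp_vec dH = dspp_mx dH *m col_mx x (col_mx y z).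
Proof.
case: dH => -[[[A B] C] D] E.
rewrite /calG /dspp_vec /dspp_mx !mul_col_mx !mul_row_col !mul0mx !addr0 !add0r.
by rewrite !mulNmx !mul_kron_rowl !mul_kron_rowr [C^T *m z - _]addrC.
Qed.

Lemma data_vec_hadamard_ddag Psi chi dH db :
  data_vec (dspp_hadamard (dspp_ddag Psi) dH) (hadamard (ddag chi) db) =
  hadamard (ddag (data_vec Psi chi)) (data_vec dH db).
Proof.
case: dH => -[[[A B] C] D] E; case: Psi => -[[[A' B'] C'] D'] E'.
rewrite /data_vec /= /ddag !map_col_mx !hadamard_col_mx.
by rewrite !vec_hadamard !vec_map.
Qed.

Lemma absmx_data_vec Psi chi :
  absmx (data_vec Psi chi) = col_mx (dspp_vec (dspp_abs Psi)) (absmx chi).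
Proof.
case: Psi => -[[[A B] C] D] E.
by rewrite /data_vec /= /absmx !map_col_mx !vec_map.
Qed.

Lemma data_vec_surj (v : 'cV[R]_(n * n + (n * m + (m * p + (m * m + p * p))) + (n + (m + p)))) :
  exists dH db, data_vec dH db = v.
Proof.
rewrite -[v]vsubmxK; move: (usubmx v) (dsubmx v) => h db.
rewrite -[h]vsubmxK; move: (usubmx h) (dsubmx h) => hA {}h.
rewrite -[h]vsubmxK; move: (usubmx h) (dsubmx h) => hB {}h.
rewrite -[h]vsubmxK; move: (usubmx h) (dsubmx h) => hC {}h.
rewrite -[h]vsubmxK; move: (usubmx h) (dsubmx h) => hD hE.
have [[A <-] [B <-] [C <-]] := And3 (vec_surj hA) (vec_surj hB) (vec_surj hC).
have [[D <-] [E <-]] := conj (vec_surj hD) (vec_surj hE).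
by exists (A, B, C, D, E), db.
Qed.

Lemma mx_norm_dspp_mx dH : `|dspp_mx dH| <= `|dspp_vec dH|.
Proof.
case: dH => -[[[A B] C] D] E; rewrite /= !mx_norm_col_mx.
have [A1 B1 C1] := And3 (mx_norm_vec A) (mx_norm_vec B) (mx_norm_vec C).
have [D1 E1] := conj (mx_norm_vec D) (mx_norm_vec E).
have [B2 C2] := conj (mx_norm_trmx B) (mx_norm_trmx C).
rewrite !ge_max.
(* One goal per block: each is zero, or a component of [dH] up to sign and
   transposition. *)
do ![apply/andP; split];
  (apply: le_trans (mx_norm_row_mx _ _) _; rewrite ge_max; apply/andP; split;
   last (apply: le_trans (mx_norm_row_mx _ _) _; rewrite ge_max; apply/andP; split));
  rewrite ?normr0 ?normrN !le_max ?normr_ge0 // ?A1 ?B1 ?C1 ?D1 ?E1 ?orbT //;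
  rewrite ?(le_trans B2 B1) ?(le_trans C2 C1) ?orbT //.
Qed.

End Structure.

(** * The limit of the supremum *)

Lemma cvg_from_linear_sandwich {R : realType} (f : R -> \bar R) (l K : R) :
  0 < K ->
  (forall e : R, 0 < e -> K * e <= 1 -> ((l - K * e)%:E <= f e <= (l + K * e)%:E)%E) ->
  f e @[e --> 0^'+] --> l%:E.
Proof.
move=> K0 fl.
have lin (c : R) : (l + c * e)%:E @[e --> 0^'+] --> l%:E.
  apply: cvg_EFin; first by near=> e.
  apply: cvg_at_right_filter; rewrite -[X in _ --> X]addr0 -[in X in _ --> X](mulr0 c).
  by apply: cvgD; [exact: cvg_cst | apply: cvgM; [exact: cvg_cst | exact: cvg_id]].
apply: (@squeeze_cvge _ _ _ _ (fun e => (l + (- K) * e)%:E) _ (fun e => (l + K * e)%:E)) => //.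
near=> e; rewrite mulNr; apply: fl; first by near: e; exact: nbhs_right_gt.
rewrite mulrC -ler_pdivlMr //; near: e; apply: nbhs_right_le; exact: divr_gt0.
Unshelve. all: by end_near.
Qed.

(** * Scaling by the weights of the solution *)

Section Theta.
Context {R : realType}.

Lemma mul_Theta {a} (v u : 'cV[R]_a) : Theta v *m u = hadamard v u.
Proof. by rewrite mul_diag_mx; apply/colP => i; rewrite !mxE. Qed.

(** A row scaling has one nonzero entry per row, so that the absolute value of
    the product involves no triangle inequality. *)
Lemma absmx_mul_Theta {a c} (v : 'cV[R]_a) (M : 'M[R]_(a, c)) :
  absmx (Theta v *m M) = absmx (Theta v) *m absmx M.
Proof.
have -> : absmx (Theta v) = Theta (absmx v).
  apply/matrixP => i j; rewrite !mxE.
  by case: (i == j); rewrite ?mulr1n ?mulr0n ?normr0.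
by rewrite !mul_diag_mx; apply/matrixP => i j; rewrite !mxE normrM.
Qed.

Lemma absmx_mul_Theta_ddag {a} (v u : 'cV[R]_a) :
  absmx (Theta (ddag v)) *m u = ediv u (absmx v).
Proof.
have -> : absmx (Theta (ddag v)) = Theta (ddag (absmx v)).
  apply/matrixP => i j; rewrite !mxE normr_eq0.
  by case: (i == j); rewrite ?mulr1n ?mulr0n ?normr0 //; case: ifP; rewrite ?normr1 ?normfV.
exact: mul_Theta.
Qed.

End Theta.

(** * The partial condition number *)

Section Condition.
Context {R : realType} {n m p k : nat}.
Variables (H : dspp R n m p) (b : 'cV[R]_(n + (m + p))) (L : 'M[R]_(k, n + (m + p))).
Variables (x : 'cV[R]_n) (y : 'cV[R]_m) (z : 'cV[R]_p).
Let w := col_mx x (col_mx y z).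
Let J := row_mx (calG x y z) (- 1%:M).
Hypotheses (Hu : dspp_mx H \in unitmx) (Hw : dspp_mx H *m w = b).

(** Both sides are [L X'^-1] applied to [b + db - X' w], since [w] is
    [X'^-1 (X' w)] as well as [X^-1 b]. *)
Lemma phi_perturb (dH : dspp R n m p) (db : 'cV[R]_(n + (m + p))) : dspp_mx (H + dH) \in unitmx ->
  phi L (H + dH) (b + db) - phi L H b =
  - (L *m (invmx (dspp_mx (H + dH)) *m (J *m data_vec dH db))).
Proof.
move=> H'u; rewrite /phi -!mulmxA -mulmxBr -Hw (mulKmx Hu) -2!mulmxN.
congr (_ *m _); rewrite -[X in _ - X](mulKmx H'u) -mulmxBr; congr (_ *m _).
rewrite /J mul_row_col calG_vec mulNmx mul1mx dspp_mxD mulmxDl.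
by rewrite addrAC opprD addrA subrr add0r opprB addrC.
Qed.

Variables (xi : 'cV[R]_k) (Psi : dspp R n m p) (chi : 'cV[R]_(n + (m + p))).
Let P := data_vec Psi chi.
Let N := Theta (ddag xi) *m (L *m invmx (dspp_mx H) *m J).

(** By [phi_perturb], the two norms compared are those of [X'^-1] and [X^-1]
    applied to the same vector [J vec(dH, db)]. Both this vector and [X' - X]
    are bounded by a multiple of the weighted norm, whence the square. *)
Lemma quotient_first_order : exists2 K : R, 0 < K &
  forall (dH : dspp R n m p) (db : 'cV[R]_(n + (m + p))),
  zero_off P (data_vec dH db) -> K * weighted_norm Psi chi dH db <= 1 ->
  dspp_mx (H + dH) \in unitmx /\
  `| `|hadamard (ddag xi) (phi L (H + dH) (b + db) - phi L H b)|
     - `|N *m data_vec dH db| | <= K * weighted_norm Psi chi dH db ^+ 2.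
Proof.
have [K0 K0gt0 HK0] := invmx_perturb _ Hu.
pose c1 : R := (n * n + (n * m + (m * p + (m * m + p * p))) + (n + (m + p)))%:R * `|J|.
pose c2 : R := (n + (m + p))%:R * `|Theta (ddag xi) *m L|.
have c1ge0 : 0 <= c1 by exact: mulr_ge0.
have c2ge0 : 0 <= c2 by exact: mulr_ge0.
(* [K0 * |P|] keeps the perturbation in the range where [invmx_perturb]
   applies; the last summand bounds the second order error. *)
pose K := 1 + K0 * `|P| + c2 * (K0 * `|P| * (c1 * `|P|)).
have KP : 0 <= K0 * `|P| by rewrite mulr_ge0 // ltW.
have KPP : 0 <= c2 * (K0 * `|P| * (c1 * `|P|)) by rewrite !mulr_ge0 // ltW.
exists K => [|dH db Pd]; first by rewrite /K -addrA ltr_pwDl // addr_ge0.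
have t0 : 0 <= weighted_norm Psi chi dH db by exact: normr_ge0.
have dt : `|data_vec dH db| <= `|P| * weighted_norm Psi chi dH db.
  rewrite /weighted_norm data_vec_hadamard_ddag -/P.
  apply: mx_norm_le => [|i j]; first exact: mulr_ge0.
  by rewrite ord1 (unweighted_entry _ _ Pd) ler_pM ?normr_mx_entry.
move: (weighted_norm _ _ _ _) t0 dt => t t0 dt Kt.
have dHt : `|dspp_mx dH| <= `|P| * t.
  by rewrite (le_trans (mx_norm_dspp_mx _)) // (le_trans _ dt) // mx_norm_col_mx le_max lexx.
have [|H'u /(_ (J *m data_vec dH db)) Hr] := HK0 (dspp_mx dH).
  apply: le_trans Kt; apply: (@le_trans _ _ (K0 * `|P| * t)).
    by rewrite -mulrA ler_wpM2l // ltW.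
  by rewrite ler_wpM2r // /K addrAC lerDr addr_ge0.
rewrite -dspp_mxD in H'u Hr; split=> //.
rewrite (phi_perturb _ _ H'u) -mul_Theta mulmxN normrN /N -!mulmxA.
rewrite (le_trans (ler_dist_dist _ _)) // -!mulmxBr mulmxA.
rewrite (le_trans (mx_norm_mul _ _)) // -/c2.
apply: (@le_trans _ _ (c2 * (K0 * `|P| * (c1 * `|P|)) * t ^+ 2)); last first.
  by rewrite ler_wpM2r ?sqr_ge0 // /K lerDr addr_ge0.
rewrite -mulrA ler_wpM2l //.
rewrite (le_trans Hr) //.
have -> : K0 * `|P| * (c1 * `|P|) * t ^+ 2 = K0 * (`|P| * t) * (c1 * (`|P| * t)) by ring.
have K0ge0 := ltW K0gt0; apply: ler_pM; rewrite ?mulr_ge0 ?ler_wpM2l //.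
by rewrite (le_trans (mx_norm_mul _ _)) // ler_wpM2l.
Qed.

Lemma sup_quotient_cvg :
  sup_quotient L xi Psi chi H b eps @[eps --> 0^'+] -->
  `|absmx N *m absmx P|%:E.
Proof.
have [K K0 HK] := quotient_first_order.
apply: (@cvg_from_linear_sandwich _ _ _ K) => // e e0 Ke.
set kappa := `|absmx N *m absmx P|.
apply/andP; split; last first.
  apply: ge_ereal_sup => _ [->|[[dH db] [/= Pd /andP[t0 te] _] <-]].
    by rewrite lee_fin addr_ge0 ?normr_ge0 ?mulr_ge0 ?ltW.
  rewrite lee_fin /rel_quotient /= ler_pdivrMr //.
  have [|_] := HK _ _ Pd; first by apply: le_trans Ke; rewrite ler_pM2l.
  rewrite ler_distl => /andP[_ /le_trans]; apply.
  have := linear_quotient_le N _ _ Pd; rewrite -data_vec_hadamard_ddag => NPd.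
  rewrite mulrDl lerD // expr2 mulrA ler_wpM2r ?(ltW t0) // ler_wpM2l //; exact: ltW.
(* When the limit value is 0 there may be no admissible perturbation at all;
   the lower bound then comes from the 0 adjoined to the quotients. *)
have [NP0|NP0] := eqVneq (absmx N *m absmx P) 0.
  apply: (@le_trans _ _ 0%E); last by apply: ereal_sup_ubound; left.
  by rewrite /kappa NP0 normr0 sub0r lee_fin oppr_le0 mulr_ge0 // ltW.
have [d [Pd dt Nd]] := linear_quotient_attained _ _ _ e0 NP0.
have [dH [db dE]] := data_vec_surj d; rewrite -dE in Pd dt Nd.
rewrite -data_vec_hadamard_ddag in dt.
have te : weighted_norm Psi chi dH db = e by [].
have [|H'u] := HK _ _ Pd; rewrite te // ler_distl => /andP[Hge _].
apply: (@le_trans _ _ (rel_quotient L xi Psi chi H b (dH, db))%:E); last first.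
  by apply: ereal_sup_ubound; right; exists (dH, db) => //; split=> //=; rewrite te e0 lexx.
rewrite lee_fin /rel_quotient /= te ler_pdivlMr // (le_trans _ Hge) //.
by rewrite mulrBl lerB // expr2 mulrA.
Qed.

End Condition.

Theorem theorem3 (R : realType) (n m p k : nat)
  (A : 'M[R]_(n, n)) (B : 'M[R]_(m, n)) (C : 'M[R]_(p, m))
  (D : 'M[R]_(m, m)) (E : 'M[R]_(p, p)) (b : 'cV[R]_(n + (m + p)))
  (L : 'M[R]_(k, n + (m + p)))
  (x : 'cV[R]_n) (y : 'cV[R]_m) (z : 'cV[R]_p) :
  let H : dspp R n m p := (A, B, C, D, E) in
  let w := col_mx x (col_mx y z) in
  let absM := absmx (L *m invmx (dspp_mx H) *m row_mx (calG x y z) (- 1%:M)) in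
  (k <= n + (m + p))%N ->
  dspp_mx H \in unitmx ->
  dspp_mx H *m w = b ->
  (forall (xi : 'cV[R]_k) (Psi : dspp R n m p) (chi : 'cV[R]_(n + (m + p))),
     cvg (sup_quotient L xi Psi chi H b eps @[eps --> 0^'+]) /\
     partial_cond L xi Psi chi H b =
       `|absmx (Theta (ddag xi)) *m absM
           *m col_mx (dspp_vec (dspp_abs Psi)) (absmx chi)|%:E) /\
  (L *m w != 0 ->
     partial_cond L (const_mx `|L *m w|) H b H b =
       (`|absM *m col_mx (dspp_vec (dspp_abs H)) (absmx b)| / `|L *m w|)%:E /\
     partial_cond L (L *m w) H b H b =
       `|ediv (absM *m col_mx (dspp_vec (dspp_abs H)) (absmx b))
              (absmx (L *m w))|%:E).

Proof.
move=> H w absM _ Hu Hw.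
have cvgS xi Psi chi : sup_quotient L xi Psi chi H b eps @[eps --> 0^'+] -->
    `|absmx (Theta (ddag xi)) *m absM
        *m col_mx (dspp_vec (dspp_abs Psi)) (absmx chi)|%:E.
  rewrite -absmx_data_vec -absmx_mul_Theta; exact: sup_quotient_cvg.
have partialE xi Psi chi : partial_cond L xi Psi chi H b =
    `|absmx (Theta (ddag xi)) *m absM
        *m col_mx (dspp_vec (dspp_abs Psi)) (absmx chi)|%:E.
  exact/(cvg_lim (@ereal_hausdorff R))/cvgS.
split=> [xi Psi chi|Lw0]; first by split=> //; apply/cvg_ex; eexists; exact: cvgS.
split; last by rewrite partialE -mulmxA absmx_mul_Theta_ddag.
rewrite partialE -mulmxA.
have -> : absmx (Theta (ddag (const_mx `|L *m w| : 'cV_k))) = (`|L *m w|^-1)%:M.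
  idtac. Show.   apply/matrixP => i j; rewrite !mxE normr_eq0 (negPf Lw0).
  by case: (i == j); rewrite ?mulr1n ?mulr0n ?normr0 // normfV normr_id.
by rewrite mul_scalar_mx normrZ normfV normr_id mulrC.
Qed.
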